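(* Let $k$ be a finite field with an odd number $q$ of elements. For any $m\geq 1$, any pair $(\mathbf{n};\mathbf{r})\in\mathcal{N}_m$ and any integer $g$, $$\sum_{j=0}^{\min(|\mathbf{n}|-1,\,g+1)}(\hat b_j-q\,\hat b_{j-1})\,u_{g-j}=\begin{cases} J\,(\hat b_{2g+2}-q\,\hat b_{2g}) & \text{if } r_i=2 \text{ for all } i \text{ and } g\ge 0;\\ 0 & \text{if } r_i=1 \text{ for some } i \text{ and } g\ge \frac{|\mathbf{n}|-1}{2},\end{cases}$$ where $u_g=u_g^{(\mathbf{n};\mathbf{r})}$, $\hat b_j=\hat b_j^{\mathbf{n}}$ and $J=J^{\mathbf n}$.
   Context: Let $k$ be a finite field with $q$ elements, $q$ odd, $k_m$ its extension of degree $m$ (inside an algebraic closure $\bar k$), and $F$ the Frobenius $x\mapsto x^q$ acting on $\mathbb{P}^1(\bar k)$. For $g\ge -1$ let $P_g$ be the set of square-free polynomials over $k$ of degree $2g+1$ or $2g+2$ (for $g=-1$: the nonzero constants). For $f\in P_g$ let $f(\infty)$ be the coefficient of $x^{2g+2}$ in $f$. Let $\chi_{2,m}$ be the quadratic character of $k_m$: it is $1$ on nonzero squares, $-1$ on nonsquares, $0$ at $0$. Put $I:=(q^3-q)^{-1}(q-1)^{-1}$. $\mathcal{N}_m$ is the set of pairs $(\mathbf{n};\mathbf{r})$ with $\mathbf{n}=(n_1,\dots,n_m)\in\mathbb{Z}_{\ge1}^m$ and $\mathbf{r}=(r_1,\dots,r_m)\in\{1,2\}^m$; $|\mathbf{n}|:=\sum_i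 n_i$. $A(\mathbf{n})$ is the set of tuples $(\alpha_1,\dots,\alpha_m)\in\prod_{i=1}^m\mathbb{P}^1(k_{n_i})$ such that for all $1\le i,j\le m$ and $s\ge0$: $F^s(\alpha_i)=\alpha_j$ implies $n_i\mid s$ and $i=j$. Put $A'(\mathbf{n}):=A(\mathbf{n})\cap\prod_i\mathbb{A}^1(k_{n_i})$. For $g\ge-1$, $$u_g^{(\mathbf{n};\mathbf{r})}:=\sum_{\alpha\in A(\mathbf{n})} I\sum_{f\in P_g}\prod_{i=1}^m\chi_{2,n_i}\bigl(f(\alpha_i)\bigr)^{r_i}.$$ For $j\ge0$, $b_j=b_j^{\mathbf{n}}$ is the number of monic polynomials $l$ over $k$ of degree $j$ with $l(\alpha_i)\ne0$ for all $i$, for any $\alpha\in A'(\mathbf{n})$; this does not depend on $\alpha$ and is given by $$b_j=q^j+\sum_{i=1}^j(-1)^i\sum_{\substack{1\le m_1<\dots<m_i\le m\\ n_{m_1}+\dots+n_{m_i}\le j}}q^{\,j-(n_{m_1}+\dots+n_{m_i})},$$ which is taken as the definition also if $A'(\mathbf{n})$ is empty. Put $\hat b_j=\hat b_j^{\mathbf n}:=\sum_{i=0}^j b_i$ (so $\hat b_{-1}=0$) and $J:=I\,(q-1)\,|A(\mathbf{n})|$. *)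

(* Defs.v *)
From mathcomp Require Import all_boot all_order all_algebra.
From mathcomp Require Import finmap.
From mathcomp Require Import all_classical.

Set Implicit Arguments.
Unset Strict Implicit.
Unset Printing Implicit Defensive.

Import Order.TTheory GRing.Theory Num.Theory.
Local Open Scope classical_set_scope.
Local Open Scope ring_scope.

(* The projective line over [K] is [option K], with [None] the point at
   infinity. *)
Definition Frob (K : fieldType) (q : nat) : option K -> option K :=
  omap (fun x => x ^+ q).

(* For [K] an algebraic closure of a field with [q] elements, the extension of
   degree [d] inside [K] is the fixed field of the [d]-th power of Frobenius. *)
Definition kext (K : fieldType) (q d : nat) : set K :=
  [set x | x ^+ (q ^ d) = x].
Arguments kext : clear implicits.

Definition P1kext (K : fieldType) (q d : nat) : set (option K) :=
  [set p | if p is Some x then kext K q d x else True].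
Arguments P1kext : clear implicits.

Definition chi2 (K : fieldType) (q d : nat) (x : K) : rat :=
  if x == 0 then 0
  else if `[< exists2 y, kext K q d y & y ^+ 2 = x >] then 1 else -1.

Definition squarefree (k : fieldType) (f : {poly k}) : Prop :=
  forall d : {poly k}, d ^+ 2 %| f -> size d = 1%N.

(* The degree of a nonzero [f] is [size f - 1]; the zero polynomial is not
   [squarefree], so [Pg k (-1)] is the set of nonzero constants. *)
Definition Pg (k : fieldType) (g : int) : set {poly k} :=
  [set f | squarefree f /\
    ((size f)%:Z - 1 = 2 * g + 1 \/ (size f)%:Z - 1 = 2 * g + 2)].
Arguments Pg : clear implicits.

(* The value at infinity depends on [g], and not only on [f]; the absolute
   value converts the index, nonnegative for [g >= -1], into a [nat]. *)
Definition evalP1 (k K : fieldType) (iota : {rmorphism k -> K}) (g : int)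
    (f : {poly k}) (p : option K) : K :=
  if p is Some x then (map_poly iota f).[x] else iota f`_(`|(2 * g + 2)%R|%N).

Definition Aset (K : fieldType) (q m : nat) (n : 'I_m -> nat) :
    set {ffun 'I_m -> option K} :=
  [set alpha | (forall i, P1kext K q (n i) (alpha i)) /\
    forall (i j : 'I_m) (s : nat),
      iter s (Frob q) (alpha i) = alpha j -> (n i %| s)%N /\ i = j].
Arguments Aset : clear implicits.
Arguments Aset K q {m} n.

Definition Iconst (q : nat) : rat :=
  (q%:R ^+ 3 - q%:R)^-1 * (q%:R - 1)^-1.

Definition u (k : finFieldType) (K : fieldType) (iota : {rmorphism k -> K})
    (m : nat) (n r : 'I_m -> nat) (g : int) : rat :=
  \sum_(alpha \in Aset K #|k| n)
    (Iconst #|k| * \sum_(f \in Pg k g)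
       \prod_(i < m) chi2 #|k| (n i) (evalP1 iota g f (alpha i)) ^+ r i).

Definition nsum (m : nat) (n : 'I_m -> nat) : nat := (\sum_(i < m) n i)%N.

(* If [Aset] contains a tuple of finite points, then [b q n j] is, by
   inclusion-exclusion, the number of monic polynomials of degree [j] over the
   base field vanishing at no point of that tuple; the formula is the definition
   also when there is no such tuple.  The inner sum is over the strictly
   increasing sequences [m_1 < ... < m_i], encoded as the subsets [S] of cardinality [i]. *)
Definition b (q m : nat) (n : 'I_m -> nat) (j : nat) : rat :=
  q%:R ^+ j + \sum_(1 <= i < j.+1) (-1) ^+ i *
    \sum_(S : {set 'I_m} | (#|S| == i) && (\sum_(l in S) n l <= j)%N)
      q%:R ^+ (j - \sum_(l in S) n l)%N.

Definition bhat (q m : nat) (n : 'I_m -> nat) (j : int) : rat :=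
  if j is Posz j' then \sum_(0 <= i < j'.+1) b q n i else 0.

Definition Jconst (K : fieldType) (q m : nat) (n : 'I_m -> nat) : rat :=
  Iconst q * (q%:R - 1) * (#|` fset_set (Aset K q n)|%fset)%:R.
Arguments Jconst : clear implicits.
Arguments Jconst K q {m} n.

(* Main.v *)
From HB Require Import structures.
Require Import Defs.
From mathcomp Require Import all_boot all_order all_algebra all_field.
From mathcomp Require Import finmap.
From mathcomp Require Import all_classical.
From mathcomp Require Import zify ring.

Set Implicit Arguments.
Unset Strict Implicit.
Unset Printing Implicit Defensive.

Import Order.TTheory GRing.Theory Num.Theory.
Local Open Scope ring_scope.

(** Fix a tuple [alpha] in [A(n)] and put [G = g + 1]. Every nonzero polynomial
[h] of degree at most [2 G], viewed as a binary form of degree [2 G], is uniquely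
[f l^2] with [f] square-free in some [P_(G-1-j)] and [l] a monic form of degree
[j], and the character product of [h] is that of [f] if [l] vanishes at no
[alpha i], and [0] otherwise. As [bhat j] counts such [l], the sum [U(G)] of
the character products over all forms of degree [2 G] is
[sum_(j <= G) bhat j * w(G - j)], with [w] the contribution of [alpha] to the
moments [u]. Moreover [bhat j = q * bhat (j - 1)] for [j >= |n|], so the left-hand
side of the theorem is the sum over [alpha] of [I * (U(G) - q * U(G - 1))]. If all
[r i = 2], then [U(G)] counts the forms vanishing at no [alpha i], which gives
[(q - 1) * bhat (2 G)]. If some [r i = 1] and [2 G + 1 >= |n|], then evaluation at
the points is equidistributed, and [U(G) = 0] because the quadratic character sums
to zero. *)

(** * Counting polynomials of bounded degree over a finite field *)

Section BoundedPolynomials.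
Variable k : finFieldType.

Implicit Types f g : {poly k}.

Definition polys (N : nat) : seq {poly k} :=
  [seq rVpoly v | v <- enum {: 'rV[k]_N}].

Lemma mem_polys N f : (f \in polys N) = (size f <= N)%N.
Proof.
apply/mapP/idP => [[v _ ->]|sf]; first exact: size_poly.
by exists (poly_rV f); rewrite ?mem_enum ?poly_rV_K.
Qed.

Lemma polys_uniq N : uniq (polys N).
Proof. by rewrite map_inj_uniq ?enum_uniq //; apply: can_inj (@rVpolyK _ _). Qed.

Lemma size_polys N : size (polys N) = (#|k| ^ N)%N.
Proof. by rewrite size_map -cardE card_mx mul1n. Qed.

Lemma perm_polys_le M N : (M <= N)%N ->
  perm_eq (polys M) [seq f : {poly k} <- polys N | (size f <= M)%N].
Proof.
move=> leMN; apply: uniq_perm; rewrite ?filter_uniq ?polys_uniq // => f.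
rewrite mem_filter !mem_polys; case: leqP => //= sf.
by rewrite (leq_trans sf).
Qed.

Lemma count_polys_le M N (P : pred {poly k}) : (M <= N)%N ->
  count (fun f : {poly k} => (size f <= M)%N && P f) (polys N) = count P (polys M).
Proof.
move=> leMN; rewrite (seq.permP (perm_polys_le leMN)) count_filter.
by apply: eq_count => f /=; rewrite andbC.
Qed.

Lemma perm_polys_add N g : (size g <= N)%N ->
  perm_eq (polys N) [seq f + g | f <- polys N].
Proof.
move=> sg; apply: uniq_perm; rewrite ?polys_uniq //.
  by rewrite map_inj_uniq ?polys_uniq //; apply: addIr.
move=> f; rewrite mem_polys; apply/idP/mapP => [sf|[h]].
  exists (f - g); last by rewrite subrK.
  by rewrite mem_polys (leq_trans (size_polyD _ _)) // size_polyN geq_max sf.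
rewrite mem_polys => sh ->.
by rewrite (leq_trans (size_polyD _ _)) // geq_max sh.
Qed.

(** Multiplication by [P] matches its multiples with the cofactors of size at most [N - deg P]. When
    [deg P >= N], the truncated subtraction gives [#|k| ^ 0 = 1], for the zero polynomial. *)
Lemma count_dvdp_polys N (P : {poly k}) : P != 0 ->
  count (fun f => P %| f) (polys N) = (#|k| ^ (N - (size P).-1))%N.
Proof.
move=> P0; rewrite -size_polys -size_filter -[RHS](size_map (fun l => l * P)).
apply/perm_size/uniq_perm; rewrite ?filter_uniq ?polys_uniq //.
  by rewrite map_inj_uniq ?polys_uniq //; apply: mulIf.
move=> f; rewrite mem_filter mem_polys; apply/andP/mapP => [[dvPf sf]|[l]].
  exists (f %/ P); last by rewrite divpK.
  by rewrite mem_polys size_divp // leq_sub2r.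
rewrite mem_polys => sl ->; split; first exact: dvdp_mulIr.
have [->|l0] := eqVneq l 0; first by rewrite mul0r size_poly0.
have: (0 < size l)%N by rewrite size_poly_gt0.
rewrite size_mul //; move: sl; case: (size l) (size P) => [|a] [|c]; lia.
Qed.

End BoundedPolynomials.

(** * Frobenius on [K] and descent of polynomials from [K] to [k] *)

Section Frobenius.
Variables (k : finFieldType) (K : closedFieldType) (emb : {rmorphism k -> K}).

Lemma exprDn_card (x y : K) : (x + y) ^+ #|k| = x ^+ #|k| + y ^+ #|k|.
Proof.
have [p p_pr chp] := finPcharP k.
apply: exprDn_pchar; rewrite (card_pprimeChar chp) pnatX; apply/orP; left.
by rewrite pnatE // (fmorph_pchar emb).
Qed.

(* [emb] is an argument only because it forces [K] to have the characteristic of [k]. *)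
Definition frob of {rmorphism k -> K} := fun x : K => x ^+ #|k|.

Fact frob_is_zmod_morphism : zmod_morphism (frob emb).
Proof.
move=> x y; apply/(addIr (y ^+ #|k|)).
by rewrite /frob -exprDn_card !subrK.
Qed.

Fact frob_is_monoid_morphism : monoid_morphism (frob emb).
Proof. by split=> [|x y]; rewrite /frob ?expr1n ?exprMn. Qed.

HB.instance Definition _ := GRing.isZmodMorphism.Build K K (frob emb)
  frob_is_zmod_morphism.
HB.instance Definition _ := GRing.isMonoidMorphism.Build K K (frob emb)
  frob_is_monoid_morphism.

Lemma frob_emb c : frob emb (emb c) = emb c.
Proof. by rewrite /frob -rmorphXn /= expf_card. Qed.

Lemma iter_frob s x : iter s (frob emb) x = x ^+ (#|k| ^ s).
Proof.
elim: s => [|s IHs]; first by rewrite expn0 expr1.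
by rewrite iterS IHs /frob -exprM expnSr.
Qed.

(** ['X^#|k| - 'X] splits over [k] into the factors ['X - c], so all its roots in [K] come from
    [k]. *)
Lemma frob_fixed x : frob emb x = x -> exists c, x = emb c.
Proof.
move=> /eqP; rewrite -subr_eq0 => fx.
have: root (map_poly emb ('X^#|k| - 'X)) x.
  by rewrite rootE rmorphB /= map_polyXn map_polyX !hornerE.
rewrite finField_genPoly rmorph_prod rootE horner_prod => /prodf_eq0[c _].
rewrite rmorphB /= map_polyX map_polyC hornerXsubC subr_eq0 => /eqP->.
by exists c.
Qed.

Lemma poly_frob_fixed (P : {poly K}) : map_poly (frob emb) P = P ->
  exists f, P = map_poly emb f.
Proof.
move=> fixP.
have /fin_all_exists[c Pc] (i : 'I_(size P)) : exists c, P`_i = emb c.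
  by apply: frob_fixed; rewrite -coef_map fixP.
exists (\poly_(i < size P) if insub i is Some i' then c i' else 0).
apply/polyP=> i; rewrite coef_map coef_poly.
case: insubP => [j -> <-|]; first by rewrite Pc.
by rewrite -leqNgt /= if_same rmorph0 => /(nth_default 0).
Qed.

Lemma root_map_frob f x :
  root (map_poly emb f) x -> root (map_poly emb f) (frob emb x).
Proof.
move=> /rootP fx; apply/rootP.
have {1}->: map_poly emb f = map_poly (frob emb) (map_poly emb f).
  by apply/polyP=> i; rewrite !coef_map /= frob_emb.
by rewrite horner_map fx rmorph0.
Qed.

(* Its roots in [K] are the distinct Frobenius conjugates of the [x i]; these
   are permuted by Frobenius, which is why the product descends to [k]. *)
Lemma exists_vanishing_poly (I : finType) (S : {set I}) (n : I -> nat) (x : I -> K) :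
  (forall i, i \in S -> iter (n i) (frob emb) (x i) = x i) ->
  (forall i, i \in S -> (0 < n i)%N) ->
  (forall i j s, i \in S -> j \in S -> iter s (frob emb) (x i) = x j ->
     (n i %| s)%N /\ i = j) ->
  exists P : {poly k}, [/\ P != 0, size P = (\sum_(i in S) n i).+1 &
    forall f, (P %| f) = [forall i in S, root (map_poly emb f) (x i)]].
Proof.
move=> fixx n0 injx.
pose zs := [seq iter s (frob emb) (x i) | i <- enum S, s <- iota 0 (n i)].
have zsP z : reflect (exists i s, [/\ i \in S, (s < n i)%N &
    z = iter s (frob emb) (x i)]) (z \in zs).
  apply: (iffP allpairsPdep) => -[i [s]].
    by rewrite mem_enum mem_iota => -[]; exists i, s.
  by case=> iS sn ->; exists i, s; rewrite mem_enum mem_iota.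
have uniq_zs : uniq zs.
  apply: allpairs_uniq_dep => [|i _|[i s] [j t]]; rewrite ?enum_uniq ?iota_uniq //.
  move=> /allpairsPdep[i' [s' []]]; rewrite mem_enum mem_iota => iS sn [? ?].
  subst i' s'.
  move=> /allpairsPdep[j' [t' []]]; rewrite mem_enum mem_iota => jS tn [? ?].
  subst j' t'.
  move: sn tn; rewrite !add0n => sn tn /= Est.
  (* Advancing both equal conjugates by [n j - t] closes the orbit of [x j]. So [i = j], and [n j]
     divides [n j - t + s], which lies strictly between [0] and [2 * n j]; hence [s = t]. *)
  have: iter (n j - t + s) (frob emb) (x i) = x j.
    by rewrite iterD Est -iterD subnK ?fixx // ltnW.
  move=> /injx[] // dv Eij; subst j.
  suff -> : s = t by [].
  move: dv => /dvdnP[[|[|c]]]; nia.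
have closed_zs z : z \in zs -> frob emb z \in zs.
  move=> /zsP[i [s [iS sn ->]]]; apply/zsP.
  have [lt|ge] := ltnP s.+1 (n i); first by exists i, s.+1.
  have Es : s.+1 = n i by apply/eqP; rewrite eqn_leq ge sn.
  exists i, 0; split => //=; first by rewrite n0.
  by rewrite -[RHS](fixx i iS) -Es.
have perm_zs : perm_eq (map (frob emb) zs) zs.
  apply: uniq_perm => //; first by rewrite map_inj_uniq //; apply: fmorph_inj.
  apply: (uniq_min_size _ _ _).2; last by rewrite size_map.
    by rewrite map_inj_uniq //; apply: fmorph_inj.
  by move=> _ /mapP[z zz ->]; apply: closed_zs.
have [|P EP] := @poly_frob_fixed (\prod_(z <- zs) ('X - z%:P)).
  rewrite rmorph_prod -[RHS](perm_big _ perm_zs) big_map.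
  by apply: eq_bigr => z _; rewrite rmorphB /= map_polyX map_polyC.
have P0 : P != 0.
  by rewrite -(map_poly_eq0 emb) -EP monic_neq0 // monic_prod_XsubC.
exists P; split => // [|f].
  rewrite -(size_map_poly emb) -EP size_prod_XsubC; congr _.+1.
  rewrite size_allpairs_dep sumnE big_map big_enum /=.
  by apply: eq_bigr => i _; rewrite size_iota.
rewrite -(dvdp_map emb) -EP; apply/idP/forall_inP => [dv i iS|rf].
  rewrite -dvdp_XsubCl (dvdp_trans _ dv) // dvdp_XsubCl root_prod_XsubC; apply/zsP.
  by exists i, 0; rewrite n0.
apply: uniq_roots_dvdp; last by rewrite uniq_rootsE.
apply/allP => _ /zsP[i [s [iS _ ->]]].
by elim: s => [|s IHs]; [apply: rf|apply: root_map_frob].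
Qed.

End Frobenius.

(** * Values of binary forms at points of the projective line *)

Lemma size_polyS_coef0 (R : nzRingType) d (f : {poly R}) :
  (size f <= d.+1)%N -> (size f <= d)%N = (f`_d == 0).
Proof.
move=> sf; apply/idP/eqP => [/(nth_default 0)//|fd0].
apply/leq_sizeP => j; rewrite leq_eqVlt => /predU1P[<-//|dj].
by rewrite nth_default // (leq_trans sf).
Qed.

Lemma coefM_top (R : nzRingType) d e (f g : {poly R}) :
  (size f <= d.+1)%N -> (size g <= e.+1)%N -> (f * g)`_(d + e) = f`_d * g`_e.
Proof.
move=> sf sg; have lt : (d < (d + e).+1)%N by lia.
rewrite coefM (bigD1 (Ordinal lt)) //= addKn big1 ?addr0 // => i.
rewrite -val_eqE /= neq_ltn => /orP[lti|lti].
  by rewrite (nth_default 0 (s := g)) ?mulr0 // (leq_trans sg) //; lia.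
by rewrite (nth_default 0 (s := f)) ?mul0r // (leq_trans sf).
Qed.

Section Evaluation.
Variables (k : finFieldType) (K : closedFieldType) (emb : {rmorphism k -> K}).

(* [f] is seen as a binary form of degree [d]. *)
Definition hev (d : nat) (f : {poly k}) (p : option K) : K :=
  if p is Some x then (map_poly emb f).[x] else emb f`_d.

Lemma evalP1E (d : nat) f p : evalP1 emb (d%:Z - 1) f p = hev (2 * d) f p.
Proof.
case: p => //=; have -> // : `|(2 * (d%:Z - 1) + 2)%R|%N = (2 * d)%N; lia.
Qed.

Lemma hevD d f g p : hev d (f + g) p = hev d f p + hev d g p.
Proof. by case: p => [x|] /=; rewrite ?rmorphD ?hornerD ?coefD ?rmorphD. Qed.

Lemma hev0 d p : hev d 0 p = 0.
Proof. by case: p => [x|] /=; rewrite ?rmorph0 ?horner0 ?coef0 ?rmorph0. Qed.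

Lemma hevN d f p : hev d (- f) p = - hev d f p.
Proof. by case: p => [x|] /=; rewrite ?rmorphN ?hornerN ?coefN ?rmorphN. Qed.

Lemma hevZ d c f p : hev d (c *: f) p = emb c * hev d f p.
Proof.
by case: p => [x|] /=; rewrite ?map_polyZ ?hornerZ ?coefZ ?rmorphM.
Qed.

Lemma hevM d e (f g : {poly k}) p : (size f <= d.+1)%N -> (size g <= e.+1)%N ->
  hev (d + e) (f * g) p = hev d f p * hev e g p.
Proof.
move=> sf sg; case: p => [x|] /=; first by rewrite rmorphM hornerM.
by rewrite coefM_top // rmorphM.
Qed.

Lemma iter_Frob_Some s (x : K) :
  iter s (Frob #|k|) (Some x) = Some (iter s (frob emb) x).
Proof. by elim: s => //= s ->. Qed.

Lemma kextE d (x : K) : kext K #|k| d x <-> iter d (frob emb) x = x.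
Proof. by rewrite iter_frob. Qed.

Lemma hev_kext n d f p : P1kext K #|k| n p -> kext K #|k| n (hev d f p).
Proof.
move=> hp; rewrite kextE; case: p hp => [x|_] /=.
  rewrite kextE => {2}<-.
  elim: n => //= n ->; rewrite -horner_map; congr _.[_].
  by apply/polyP=> i; rewrite !coef_map /= frob_emb.
by elim: n => //= n ->; rewrite frob_emb.
Qed.

Section Points.
Variables (m : nat) (n : 'I_m -> nat) (alpha : {ffun 'I_m -> option K}).
Hypotheses (n_gt0 : forall i, (0 < n i)%N) (hA : Aset K #|k| n alpha).

(** Vanishing at the finite points of [S] is divisibility by a polynomial whose degree is the sum of
    their [n i]; vanishing at infinity, a point with [n i = 1], lowers the size bound by one. *)
Lemma count_vanishing (S : {set 'I_m}) d :
  count (fun f => [forall i in S, hev d f (alpha i) == 0]) (polys k d.+1) =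
  (#|k| ^ (d.+1 - \sum_(i in S) n i))%N.
Proof.
have [hfix hinj] := hA.
(* Frobenius fixes infinity, so the case [s = 1] forces [n i = 1]. *)
have n_inf i : alpha i = None -> n i = 1%N.
  move=> ai; have [] := hinj i i 1%N; first by rewrite /= ai.
  by rewrite dvdn1 => /eqP.
pose x i := odflt 0 (alpha i); pose S' := [set i in S | alpha i != None].
have S'x i : i \in S' -> alpha i = Some (x i).
  by rewrite inE /x => /andP[_]; case: (alpha i).
have [|||P [P0 sP dvP]] := @exists_vanishing_poly k K emb _ S' n x.
- by move=> i /S'x ai; have := hfix i; rewrite /P1kext ai => /kextE.
- by [].
- move=> i j s /S'x ai /S'x aj ij; apply: hinj.
  by rewrite ai aj iter_Frob_Some ij.
have dvPE f : (P %| f) = [forall i in S', hev d f (alpha i) == 0].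
  by rewrite dvP; apply: eq_forallb_in => i /S'x->.
have [/exists_inP[i0 i0S /eqP ai0]|noinf] :=
    boolP [exists i in S, alpha i == None].
  (* Infinity occurs at one index only: two such indices coincide by the case [s = 0]. *)
  have ES : S = i0 |: S'.
    apply/setP=> i; rewrite !inE; have [->//|ni] := eqVneq i i0.
    have [iS|//] := boolP (i \in S); apply/esym/eqP => ai.
    by case/eqP: ni; have [] := hinj i i0 0%N; rewrite //= ai ai0.
  have i0S' : i0 \notin S' by rewrite inE ai0 eqxx andbF.
  have -> : (d.+1 - \sum_(i in S) n i = d - (size P).-1)%N.
    by rewrite ES big_setU1 //= n_inf // sP add1n subSS.
  rewrite -count_dvdp_polys // -(@count_polys_le _ d d.+1) //.
  apply: eq_in_count => f; rewrite mem_polys => sf.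
  rewrite size_polyS_coef0 // dvPE ES; apply/forall_inP/andP => [h|].
    split; last by apply/forall_inP => i iS'; apply: h; rewrite setU1r.
    by have := h i0 (setU11 _ _); rewrite ai0 /= fmorph_eq0 => ->.
  case=> f0 /forall_inP h i; case/setU1P => [->|/h//].
  by rewrite ai0 /= fmorph_eq0.
have ES : S' = S.
  apply/setP=> i; rewrite inE andb_idr // => iS; apply: contra noinf => ai.
  by apply/exists_inP; exists i.
rewrite -ES -[(\sum_(i in S') n i)%N]/((\sum_(i in S') n i).+1.-1)%N -sP -count_dvdp_polys //.
exact: eq_count.
Qed.

End Points.
End Evaluation.

(** * Inclusion-exclusion formulas for [b] and [bhat] *)

Section InclusionExclusion.
Variables (q m : nat) (n : 'I_m -> nat).
Hypotheses (q_gt1 : (1 < q)%N) (m_gt0 : (0 < m)%N).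
Hypothesis n_gt0 : forall i, (0 < n i)%N.

(* The subsets [S] of total degree exceeding [N] count with weight
   [q ^ 0 = 1], by truncated subtraction: they account for the zero form. *)
Definition altsum (N : nat) : rat :=
  \sum_(S : {set 'I_m}) (-1) ^+ #|S| * q%:R ^+ (N - \sum_(l in S) n l).

(** At [N = 0] all powers of [q] are [1], which leaves the expansion of [(-1 + 1) ^ m] with
    [m > 0]. *)
Lemma altsum0 : altsum 0 = 0.
Proof.
transitivity (\prod_(i : 'I_m) ((-1) + 1 : rat)).
  rewrite bigA_distr; apply: eq_bigr => S _.
  by rewrite sub0n expr0 mulr1 -big_mkcond prodr_const.
by rewrite addNr (bigD1 (Ordinal m_gt0)) //= mul0r.
Qed.

Lemma bE j : b q n j =
  \sum_(S : {set 'I_m} | (\sum_(l in S) n l <= j)%N)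
     (-1) ^+ #|S| * q%:R ^+ (j - \sum_(l in S) n l).
Proof.
(* As each [n l >= 1], the cardinality of [S] is at most its total degree, so the bound [i <= j] in
   [b] excludes no admissible subset. *)
have card_le (S : {set 'I_m}) : (\sum_(l in S) n l <= j)%N -> (#|S| < j.+1)%N.
  rewrite ltnS; apply: leq_trans; rewrite -sum1_card; exact: leq_sum.
rewrite (partition_big (fun S : {set 'I_m} => inord #|S| : 'I_j.+1) predT) //=.
rewrite big_ord_recl /b big_add1 big_mkord; congr (_ + _).
  rewrite (big_pred1 finset.set0) => [|S]; first by rewrite cards0 expr0 big_set0 mul1r subn0.
  rewrite /= -cards_eq0; have [/card_le lt|] := leqP (\sum_(l in S) n l) j.
    by rewrite -val_eqE /= inordK.
  by move=> lt; apply/esym/negP; rewrite cards_eq0 => /eqP S0; rewrite S0 big_set0 in lt.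
apply: eq_bigr => i _; rewrite mulr_sumr; apply: eq_big => [S|S /andP[/eqP-> _]//].
rewrite andbC; have [/card_le lt|//] := leqP (\sum_(l in S) n l) j.
by rewrite -val_eqE /= inordK.

Qed.

(** A subset of total degree above [N] contributes the same sign to both sums and cancels; any other
    contributes [q - 1] times its term at [N]. *)
Lemma altsumS N : altsum N.+1 - altsum N = (q%:R - 1) * b q n N.
Proof.
rewrite bE big_mkcond mulr_sumr -sumrB; apply: eq_bigr => S _.
case: leqP => [le|lt]; first by rewrite subSn // exprS; ring.
by rewrite (eqP lt) (eqP (ltnW lt)); ring.
Qed.

Lemma bhat_altsum d : (q%:R - 1) * bhat q n d%:Z = altsum d.+1.
Proof.
rewrite /= mulr_sumr; have := telescope_sumr altsum (leq0n d.+1); rewrite altsum0 subr0 => <-.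
by apply: eq_bigr => i _; rewrite altsumS.
Qed.

Lemma q_sub1_neq0 : q%:R - 1 != 0 :> rat.
Proof. by rewrite subr_eq0 (eqr_nat _ q 1) neq_ltn q_gt1 orbT. Qed.

(** Once [d >= nsum n], no exponent in [altsum] at [d] is truncated, so passing from [d] to [d + 1]
    multiplies each term by exactly [q]. *)
Lemma bhat_geom d : (nsum n <= d)%N ->
  bhat q n d%:Z - q%:R * bhat q n (d%:Z - 1) = 0.
Proof.
case: d => [|d] led.
  by move: led; rewrite /nsum (bigD1 (Ordinal m_gt0)) //= leqn0 addn_eq0 -leqn0 leqNgt n_gt0.
apply: (mulfI q_sub1_neq0); rewrite mulr0 mulrBr mulrCA.
have -> : d.+1%:Z - 1 = d%:Z by lia.
rewrite !bhat_altsum mulr_sumr -sumrB big1 // => S _.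
have le : (\sum_(l in S) n l <= d.+1)%N.
  apply: leq_trans led; rewrite /nsum [leqRHS](bigID [in S]) /=; exact: leq_addr.
by rewrite subSn // exprS; ring.
Qed.

End InclusionExclusion.

(** * Counting forms that vanish at no point of the tuple *)

Section NonvanishingForms.
Variables (k : finFieldType) (K : closedFieldType) (emb : {rmorphism k -> K}).
Variables (m : nat) (n : 'I_m -> nat) (alpha : {ffun 'I_m -> option K}).
Hypotheses (m_gt0 : (0 < m)%N) (n_gt0 : forall i, (0 < n i)%N).
Hypothesis hA : Aset K #|k| n alpha.

Definition nonvanishing d (f : {poly k}) :=
  [forall i, hev emb d f (alpha i) != 0].

Lemma nonvanishing_neq0 d f : nonvanishing d f -> f != 0.
Proof.
by apply: contraTneq => ->; apply/forallPn; exists (Ordinal m_gt0); rewrite hev0 negbK.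
Qed.

Lemma natr_forall_in (R : comNzRingType) (I : finType) (A : pred I) (P : pred I) :
  [forall i in A, P i]%:R = \prod_(i in A) (P i)%:R :> R.
Proof.
have [/forall_inP h|/forall_inPn[i Ai /negPf nPi]] := boolP [forall i in A, P i].
  by rewrite big1 // => i /h->.
by rewrite (bigD1 i) //= nPi mul0r.
Qed.

Lemma count_nonvanishing d :
  (count (nonvanishing d) (polys k d.+1))%:R = altsum #|k| n d.+1.
Proof.
rewrite -sum1_count natr_sum big_mkcond /=.
pose van f (S : {set 'I_m}) := [forall i in S, hev emb d f (alpha i) == 0].
transitivity (\sum_(f <- polys k d.+1) \sum_(S : {set 'I_m})
    (-1) ^+ #|S| * (van f S)%:R : rat).
  apply: eq_bigr => f _.
  (* The indicator of nonvanishing is a product of factors [1 - [vanishing at alpha i]]; expanding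
     it over the subsets [S] is inclusion-exclusion. *)
  transitivity (\prod_i (- (hev emb d f (alpha i) == 0)%:R + 1 : rat)).
    rewrite -[if _ then _ else _]/(if nonvanishing d f then (1 : rat) else 0).
    have -> : nonvanishing d f = [forall i in predT, hev emb d f (alpha i) != 0].
      by apply: eq_forallb => i.
    transitivity ([forall i in predT, hev emb d f (alpha i) != 0]%:R : rat).
      by case: ifP.
    rewrite natr_forall_in; apply: eq_bigr => i _.
    by case: eqP; rewrite ?addNr // oppr0 add0r.
  rewrite bigA_distr; apply: eq_bigr => S _.
  by rewrite -big_mkcond prodrN natr_forall_in.
rewrite exchange_big; apply: eq_bigr => S _ /=.
rewrite -mulr_sumr -natr_sum -natrX -(count_vanishing emb n_gt0 hA); congr (_ * _%:R).
by rewrite -sum1_count [RHS]big_mkcond; apply: eq_bigr => f _; rewrite /van; case: [forall i in S, _].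
Qed.

(** The [#|k| - 1] nonzero scalars act freely on the nonvanishing forms, with one monic form in each
    orbit, and [bhat_altsum] carries the same factor. This covers tuples with a point at infinity
    too. *)
Lemma count_monic_nonvanishing d :
  (count (fun l => (l \is monic) && nonvanishing d l) (polys k d.+1))%:R =
  bhat #|k| n d%:Z.
Proof.
have q1 : (1 < #|k|)%N by apply: card_finNzRing_gt1.
apply: (mulfI (q_sub1_neq0 q1)); rewrite bhat_altsum // -count_nonvanishing.
have -> : #|k|%:R - 1 = (#|k| - 1)%N%:R :> rat by rewrite natrB // ltnW.
rewrite -natrM; congr (_%:R).
rewrite -!size_filter.
set mon := [seq l <- _ | _ && _].
have <- : size [seq c *: l | c <- enum [pred c : k | c != 0], l <- mon] =
    ((#|k| - 1) * size mon)%N.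
  rewrite size_allpairs -cardE; congr (_ * _)%N.
  by rewrite subn1 -(cardC1 (0 : k)); apply: eq_card.
apply/perm_size/uniq_perm; rewrite ?filter_uniq ?polys_uniq //.
  apply: allpairs_uniq; rewrite ?enum_uniq ?filter_uniq ?polys_uniq //.
  move=> [c l] [c' l'] /allpairsP[[c1 l1] /=[+ + [-> ->]]].
  rewrite mem_enum inE mem_filter => c0 /andP[/andP[ml _] _].
  move=> /allpairsP[[c2 l2] /=[+ + [-> ->]]].
  rewrite mem_enum inE mem_filter => c20 /andP[/andP[ml2 _] _] E.
  have Ec : c1 = c2.
    move/(congr1 lead_coef): E; rewrite !lead_coefZ (monicP ml) (monicP ml2).
    by rewrite !mulr1.
  by move: E; rewrite Ec => /(scalerI c20)->.
move=> f; rewrite mem_filter; apply/allpairsP/andP => [[[c l] /= []]|].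
  rewrite mem_enum inE !mem_filter !mem_polys => c0 /andP[/andP[_ nl] sl] ->.
  rewrite size_scale //; split => //; apply/forallP => i.
  by rewrite hevZ mulf_neq0 ?fmorph_eq0 //; apply: (forallP nl).
case=> nf sf; have f0 := nonvanishing_neq0 nf.
have lf0 : lead_coef f != 0 by rewrite lead_coef_eq0.
exists (lead_coef f, (lead_coef f)^-1 *: f) => /=.
rewrite mem_enum inE lf0 scalerA divff // scale1r; split => //.
rewrite mem_filter mem_polys size_scale ?invr_eq0 // -mem_polys sf andbT.
rewrite monicE lead_coefZ mulVf // eqxx /=; apply/forallP => i.
by rewrite hevZ mulf_neq0 ?fmorph_eq0 ?invr_eq0 //; apply: (forallP nf).
Qed.

End NonvanishingForms.

(** * Unique decomposition into a square-free polynomial and a monic square *)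

Section SquarefreeDecomposition.
Variable k : fieldType.
Implicit Types f h l : {poly k}.

Lemma squarefree_neq0 f : squarefree f -> f != 0.
Proof.
move=> sqf; apply/eqP => f0; have := sqf 0.
by rewrite f0 expr0n dvdp0 size_poly0 => /(_ isT).
Qed.

Lemma squarefree_decomposition h : h != 0 ->
  exists f l, [/\ squarefree f, l \is monic & h = f * l ^+ 2].
Proof.
have [s] := ubnP (size h); elim: s h => // s IHs h; rewrite ltnS => hs h0.
have [sqf|/existsNP[d /not_implyP[dvd /eqP sd]]] := pselect (squarefree h).
  by exists h, 1; rewrite expr1n mulr1 monic1.
have d0 : d != 0 by apply: contraTneq dvd => ->; rewrite expr0n dvd0p.
have ld0 : lead_coef d != 0 by rewrite lead_coef_eq0.
have [h' Eh] := dvdpP _ _ dvd.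
have h'0 : h' != 0 by apply: contraNneq h0 => h'0; rewrite Eh h'0 mul0r.
(* The divisor [d] is made monic, its leading coefficient moving into the cofactor. *)
have [||f [l [sqf ml Eh']]] := IHs (lead_coef d ^+ 2 *: h').
- rewrite size_scale ?expf_neq0 //; apply: leq_trans hs; rewrite Eh.
  have : (0 < size d)%N by rewrite size_poly_gt0.
  have : (0 < size h')%N by rewrite size_poly_gt0.
  rewrite expr2 !size_mul ?mulf_neq0 //.
  by move: sd; case: (size d) (size h') => [|[|a]] [|c]; lia.
- by rewrite scaler_eq0 negb_or expf_neq0.
exists f, (l * ((lead_coef d)^-1 *: d)); split => //.
  by rewrite monicMl // monicE lead_coefZ mulVf.
rewrite exprMn mulrA -Eh' Eh exprZn -!(scalerAl, scalerAr) scalerA.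
by rewrite -exprMn divff // expr1n scale1r.
Qed.

(** With [l = a * d], [l' = c * d] and [d] the gcd, [c ^+ 2] divides [f * a ^+ 2] and is coprime to
    [a], so it divides the square-free [f] and [c] is constant. By symmetry so is [a], and the monic
    [l] and [l'] are associates. *)
Lemma squarefree_decomposition_uniq f l f' l' :
  squarefree f -> squarefree f' -> l \is monic -> l' \is monic ->
  f * l ^+ 2 = f' * l' ^+ 2 -> f = f' /\ l = l'.
Proof.
move=> sqf sqf' ml ml' E.
have l0 := monic_neq0 ml; have l'0 := monic_neq0 ml'.
pose d := gcdp l l'; have d0 : d != 0 by rewrite gcdp_eq0 negb_and l0.
pose a := l %/ d; pose c := l' %/ d.
have El : l = a * d by rewrite divpK ?dvdp_gcdl.
have El' : l' = c * d by rewrite divpK ?dvdp_gcdr.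
have cop : coprimep a c by rewrite coprimep_div_gcd // l0.
have Eac : f * a ^+ 2 = f' * c ^+ 2.
  by apply: (mulIf (expf_neq0 2 d0)); rewrite -[LHS]mulrA -[RHS]mulrA -!exprMn -El -El'.
have sc : size c = 1%N.
  apply: sqf; rewrite -(@Gauss_dvdpl _ _ (a ^+ 2)); last first.
    by rewrite coprimep_expl // coprimep_expr // coprimep_sym.
  by rewrite Eac dvdp_mulIr.
have sa : size a = 1%N.
  apply: sqf'; rewrite -(@Gauss_dvdpl _ _ (c ^+ 2)); last first.
    by rewrite coprimep_expl // coprimep_expr.
  by rewrite -Eac dvdp_mulIr.
have eql : l %= l'.
  apply: (@eqp_trans _ d); last rewrite eqp_sym.
    by rewrite {1}El -[X in _ %= X]mul1r eqp_mul2r // -size_poly_eq1 sa.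
  by rewrite {1}El' -[X in _ %= X]mul1r eqp_mul2r // -size_poly_eq1 sc.
have Ell : l = l' by apply/eqP; rewrite -eqp_monic.
by split => //; move: E; rewrite Ell => /(mulIf (expf_neq0 2 l'0)).
Qed.

End SquarefreeDecomposition.

(** * Sums over forms through the square-free decomposition *)

Section SquarefreeSum.
Variable k : finFieldType.

(* A square-free [f] belongs to [P_g] exactly for [g = level f - 1]. *)
Definition level (f : {poly k}) : nat := (size f)./2.

Definition sqpolys N : seq {poly k} := [seq f <- polys k N | `[< squarefree f >]].
(** With degree at most [d], these stand for the monic forms of degree [d]; a drop in degree is a
    zero at infinity. *)
Definition monpolys d : seq {poly k} := [seq l <- polys k d.+1 | l \is monic].

Lemma mem_sqpolys N f : (f \in sqpolys N) = (size f <= N)%N && `[< squarefree f >].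
Proof. by rewrite mem_filter mem_polys andbC. Qed.

Lemma mem_monpolys d l : (l \in monpolys d) = (size l <= d.+1)%N && (l \is monic).
Proof. by rewrite mem_filter mem_polys andbC. Qed.

(** As [deg f] is [2 * level f - 1] or [2 * level f], the product [f * l ^+ 2] has degree at most
    [2 * G] exactly when [deg l <= G - level f], in both cases. *)
Lemma perm_decomposition G :
  perm_eq [seq h <- polys k (2 * G).+1 | h != 0]
    [seq f * l ^+ 2 | f <- sqpolys (2 * G).+1, l <- monpolys (G - level f)].
Proof.
have size_sq (f l : {poly k}) : squarefree f -> l \is monic ->
    size (f * l ^+ 2) = (size f + 2 * (size l).-1)%N /\ (0 < size l)%N.
  move=> /squarefree_neq0 f0 /monic_neq0 l0.
  have sl : (0 < size l)%N by rewrite size_poly_gt0.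
  have sf : (0 < size f)%N by rewrite size_poly_gt0.
  split => //; rewrite expr2 !size_mul ?mulf_neq0 //.
  by case: (size l) (size f) sl sf => [|a] [|c] //; lia.
apply: uniq_perm; rewrite ?filter_uniq ?polys_uniq //.
  apply: allpairs_uniq_dep => [|f _|[f l] [f' l']]; rewrite ?filter_uniq ?polys_uniq //.
  move=> /allpairsPdep[f1 [l1 []]]; rewrite mem_sqpolys mem_monpolys.
  move=> /andP[_ /asboolP sqf] /andP[_ ml] [-> ->].
  move=> /allpairsPdep[f2 [l2 []]]; rewrite mem_sqpolys mem_monpolys.
  move=> /andP[_ /asboolP sqf2] /andP[_ ml2] [-> ->] /= E.
  by have [-> ->] := squarefree_decomposition_uniq sqf sqf2 ml ml2 E.
move=> h; rewrite mem_filter mem_polys; apply/andP/allpairsPdep => [[h0 sh]|].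
  have [f [l [sqf ml Eh]]] := squarefree_decomposition h0.
  have [E sl] := size_sq f l sqf ml; rewrite /level Eh E in sh.
  exists f, l; rewrite mem_sqpolys mem_monpolys /level ml andbT Eh; split => //.
    by apply/andP; split; [lia|apply/asboolP].
  by move: (size f) (size l) sh sl => a c; rewrite /level; lia.
move=> [f [l []]]; rewrite mem_sqpolys mem_monpolys /level.
move=> /andP[sf /asboolP sqf] /andP[sl ml] ->.
have [E _] := size_sq f l sqf ml; rewrite E.
rewrite mulf_neq0 ?expf_neq0 ?(squarefree_neq0 sqf) ?(monic_neq0 ml) //; split=> //.
by move: (size f) (size l) sf sl => a c; lia.
Qed.

Lemma sum_decomposition (V : nmodType) G (F : {poly k} -> V) : F 0 = 0 ->
  \sum_(h <- polys k (2 * G).+1) F h =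
  \sum_(f <- sqpolys (2 * G).+1) \sum_(l <- monpolys (G - level f)) F (f * l ^+ 2).
Proof.
move=> F0; rewrite (bigID (fun h => h != 0)) /= [X in _ + X]big1 => [|h]; last first.
  by rewrite negbK => /eqP->.
by rewrite addr0 -big_filter (perm_big _ (perm_decomposition G)) big_allpairs_dep.
Qed.

End SquarefreeSum.

(** * Invariance of the quadratic character under nonzero squares *)

Section QuadraticCharacter.
Variables (K : fieldType) (q d : nat).

Lemma chi2_0 : chi2 q d (0 : K) = 0.
Proof. by rewrite /chi2 eqxx. Qed.

Lemma kextM (x y : K) : kext K q d x -> kext K q d y -> kext K q d (x * y).
Proof. by rewrite /kext /= exprMn => -> ->. Qed.

Lemma kextV (x : K) : kext K q d x -> kext K q d x^-1.
Proof. by rewrite /kext /= exprVn => ->. Qed.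

Lemma chi2_mul_sqr (x y : K) : kext K q d y -> y != 0 ->
  chi2 q d (x * y ^+ 2) = chi2 q d x.
Proof.
move=> ky y0; rewrite /chi2 mulf_eq0 expf_eq0 (negPf y0) orbF.
case: eqP => // _; congr (if _ then _ else _).
apply/asboolP/asboolP => [[z kz Ez]|[z kz <-]].
  exists (z * y^-1); first exact: kextM (kextV _).
  by rewrite exprMn Ez exprVn mulfK // expf_neq0.
by exists (z * y); [apply: kextM|rewrite exprMn].
Qed.

End QuadraticCharacter.

(** * Character products of forms and their square-free parts *)

Section CharacterProducts.
Variables (k : finFieldType) (K : closedFieldType) (emb : {rmorphism k -> K}).
Variables (m : nat) (n r : 'I_m -> nat) (alpha : {ffun 'I_m -> option K}).
Hypotheses (m_gt0 : (0 < m)%N) (n_gt0 : forall i, (0 < n i)%N).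
Hypothesis r_gt0 : forall i, (0 < r i)%N.
Hypothesis hA : Aset K #|k| n alpha.

Definition chiprod (a : nat) (f : {poly k}) : rat :=
  \prod_(i < m) chi2 #|k| (n i) (hev emb (2 * a) f (alpha i)) ^+ r i.

Lemma chiprod_eq0 a f : ~~ nonvanishing emb alpha (2 * a) f -> chiprod a f = 0.
Proof.
move=> /forallPn[i]; rewrite negbK => /eqP fi0.
by rewrite /chiprod (bigD1 i) //= fi0 chi2_0 expr0n eqn0Ngt r_gt0 mul0r.
Qed.

Lemma chiprod0 a : chiprod a 0 = 0.
Proof.
by apply: chiprod_eq0; apply/negP => /(nonvanishing_neq0 m_gt0) /eqP.
Qed.

(** The value of [l] at [alpha i] lies in the extension of degree [n i], so if nonzero its square
    leaves the character unchanged; at a zero of [l] the product vanishes because [r i > 0]. *)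
Lemma chiprod_mul_sqr a j (f l : {poly k}) :
  (size f <= (2 * a).+1)%N -> (size l <= j.+1)%N ->
  chiprod (a + j) (f * l ^+ 2) =
  if nonvanishing emb alpha j l then chiprod a f else 0.
Proof.
move=> sf sl.
have E p : hev emb (2 * (a + j)) (f * l ^+ 2) p = hev emb (2 * a) f p * hev emb j l p ^+ 2.
  have -> : (2 * (a + j) = 2 * a + (j + j))%N by lia.
  rewrite expr2 !hevM // (leq_trans (size_polyMleq _ _)) //.
  by move: (size l) sl => c; lia.
case: ifPn => [/forallP nl|nl].
  apply: eq_bigr => i _; rewrite E chi2_mul_sqr //.
  exact: hev_kext (hA.1 i).
apply: chiprod_eq0; apply: contra nl => /forallP nfl; apply/forallP => i.
by have := nfl i; rewrite E mulf_eq0 negb_or expf_eq0 => /andP[].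
Qed.

(* The unnormalised contribution of [alpha] to [u_(a - 1)]. *)
Definition sqsum (a : nat) : rat :=
  \sum_(f <- sqpolys k (2 * a).+1 | level f == a) chiprod a f.

(** Level [a] already bounds the size by [2 * a + 1]. *)
Lemma sqsumE G a : (a <= G)%N ->
  sqsum a = \sum_(f <- sqpolys k (2 * G).+1 | level f == a) chiprod a f.
Proof.
move=> leaG; rewrite /sqsum -big_filter -[RHS]big_filter; apply/perm_big/uniq_perm.
- by rewrite !filter_uniq ?polys_uniq.
- by rewrite !filter_uniq ?polys_uniq.
move=> f; rewrite !mem_filter !mem_polys /level; case: eqP => //= Ef.
case: asboolP => //= _; move: (size f) Ef => c Ef.
have -> : (c <= (2 * a).+1)%N by lia.
by have -> : (c <= (2 * G).+1)%N by lia.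
Qed.

Lemma sum_chiprod G : \sum_(h <- polys k (2 * G).+1) chiprod G h =
  \sum_(j < G.+1) bhat #|k| n j%:Z * sqsum (G - j).
Proof.
rewrite sum_decomposition ?chiprod0 //.
(* For fixed [f], only the [l] vanishing nowhere on the tuple contribute, each by
   [chiprod (level f) f]; [bhat] at [G - level f] counts them. *)
transitivity (\sum_(f <- sqpolys k (2 * G).+1)
    bhat #|k| n (G - level f)%:Z * chiprod (level f) f).
  rewrite big_seq [RHS]big_seq; apply: eq_bigr => f.
  rewrite mem_sqpolys => /andP[sf _].
  have lf : (level f <= G)%N by rewrite /level; move: (size f) sf => c; lia.
  rewrite -(count_monic_nonvanishing emb m_gt0 n_gt0 hA).
  rewrite -sum1_count natr_sum mulr_suml /monpolys big_filter [RHS]big_mkcondr /=.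
  rewrite big_seq_cond [RHS]big_seq_cond; apply: eq_bigr => l.
  rewrite mem_polys => /andP[sl _].
  rewrite mul1r -[in LHS](subnKC lf) chiprod_mul_sqr //.
  by rewrite /level; move: (size f) => c; lia.
rewrite [RHS](reindex_inj rev_ord_inj) /=.
transitivity (\sum_(a < G.+1) \sum_(f <- sqpolys k (2 * G).+1 | level f == a)
    bhat #|k| n (G - level f)%:Z * chiprod (level f) f).
  rewrite (exchange_big_dep predT) //= big_seq [RHS]big_seq; apply: eq_bigr => f.
  rewrite mem_sqpolys => /andP[sf _].
  have lf : (level f < G.+1)%N by rewrite /level; move: (size f) sf => c; lia.
  by rewrite (big_pred1 (Ordinal lf)) // => a; rewrite -val_eqE eq_sym.
apply: eq_bigr => a _; rewrite subSS subKn ?leq_ord // (@sqsumE G) ?leq_ord //.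
by rewrite mulr_sumr; apply: eq_bigr => f /eqP->.
Qed.

End CharacterProducts.

(** * Quadratic character sums over a finite extension of [k] *)

Section CharacterSum.
Variables (k : finFieldType) (K : closedFieldType) (emb : {rmorphism k -> K}).
Hypothesis odd_q : odd #|k|.

Lemma two_neq0 : (2%:R : K) != 0.
Proof.
have [p p_pr chp] := finPcharP k.
have odd_p : odd p.
  have : (p %| #|k|)%N.
    rewrite (card_pprimeChar chp) dvdn_exp //.
    rewrite -(ltn_exp2l _ _ (prime_gt1 p_pr)) expn0 -(card_pprimeChar chp).
    exact: card_finNzRing_gt1.
  by move=> /dvdnP[c Ec]; move: odd_q; rewrite Ec oddM => /andP[].
have chK : p \in [pchar K] by rewrite (fmorph_pchar emb).
rewrite -(dvdn_pcharf chK); apply/negP => dv.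
by move: (@dvdn_leq p 2 isT dv) (prime_gt1 p_pr) odd_p; case: (p) => [|[|[|]]].
Qed.

Section Extension.
Variable d : nat.

Lemma kextD (x y : K) : kext K #|k| d x -> kext K #|k| d y -> kext K #|k| d (x + y).
Proof.
rewrite !(kextE emb) => hx hy; rewrite -{2}hx -{2}hy.
by elim: (d) => //= e ->; rewrite rmorphD.
Qed.

Lemma kextN (x : K) : kext K #|k| d x -> kext K #|k| d (- x).
Proof.
rewrite !(kextE emb) => hx; rewrite -{2}hx.
by elim: (d) => //= e ->; rewrite rmorphN.
Qed.

(** These are the roots of ['X^Q - 'X]. An upper bound on their number suffices later, which avoids
    showing that the roots are simple. *)
Lemma exists_kext_seq : (0 < d)%N -> exists Y : seq K,
  [/\ uniq Y, (size Y <= #|k| ^ d)%N & forall x, x \in Y <-> kext K #|k| d x].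
Proof.
move=> d0; pose Q := (#|k| ^ d)%N.
have Q1 : (1 < Q)%N by rewrite -(expn0 #|k|) ltn_exp2l ?card_finNzRing_gt1.
pose P : {poly K} := 'X^Q - 'X.
have sP : size P = Q.+1 by rewrite size_polyDl ?size_polyXn // size_polyN size_polyX.
have P0 : P != 0 by rewrite -size_poly_eq0 sP.
have [rs EP] := closed_field_poly_normal P.
have rsP x : (x \in rs) = root P x.
  by rewrite EP rootZ ?lead_coef_eq0 // root_prod_XsubC.
exists (undup rs); split; first exact: undup_uniq.
  rewrite -ltnS -sP max_poly_roots ?undup_uniq //.
  by apply/allP => x; rewrite mem_undup rsP.
move=> x; rewrite mem_undup rsP rootE !hornerE subr_eq0; split; by move/eqP.
Qed.

Variable Y : seq K.
Hypotheses (uY : uniq Y) (YP : forall x, x \in Y <-> kext K #|k| d x).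

(* Squaring is two-to-one onto the nonzero squares: [x] has [1 + chi2 x]
   square roots. *)
Lemma sum_chi2 : \sum_(y <- Y) chi2 #|k| d y = 0.
Proof.
pose Z := [seq y <- Y | y != 0].
have uZ : uniq Z by rewrite filter_uniq.
have roots x : x \in Z ->
    (\sum_(y <- Z) (y ^+ 2 == x)%:R = 1 + chi2 #|k| d x :> rat).
  rewrite mem_filter => /andP[x0 _]; rewrite -natr_sum.
  have -> : (\sum_(y <- Z) (y ^+ 2 == x) = count (fun y => y ^+ 2 == x) Z)%N.
    by rewrite -sum1_count [RHS]big_mkcond; apply: eq_bigr => y _; case: eqP.
  rewrite /chi2 (negPf x0); case: asboolP => [[y ky Ey]|nsq].
    have y0 : y != 0 by apply: contraNneq x0 => y0; rewrite -Ey y0 expr0n.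
    have yN : y != - y.
      by rewrite -addr_eq0 -mulr2n -mulr_natr mulf_neq0 // two_neq0.
    rewrite -size_filter.
    have /perm_size -> // : perm_eq [seq z <- Z | z ^+ 2 == x] [:: y; - y].
    apply: uniq_perm; rewrite ?filter_uniq //= ?inE ?yN // => z.
    rewrite !mem_filter !inE -Ey eqf_sqr; case: eqP => [->|_] /=.
      by rewrite y0; apply/YP.
    by case: eqP => //= ->; rewrite oppr_eq0 y0; apply/YP/kextN.
  rewrite subrr; apply/eqP; rewrite pnatr_eq0 -leqn0 leqNgt -has_count.
  apply/hasPn => y; rewrite mem_filter => /andP[_ /YP ky].
  by apply/negP => /eqP Ey; apply: nsq; exists y.
have: \sum_(x <- Z) \sum_(y <- Z) (y ^+ 2 == x)%:R =
      \sum_(x <- Z) (1 + chi2 #|k| d x).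
  by rewrite big_seq [RHS]big_seq; apply: eq_bigr => x /roots.
rewrite exchange_big big_split /=.
have -> : \sum_(y <- Z) \sum_(x <- Z) (y ^+ 2 == x)%:R = \sum_(y <- Z) (1 : rat).
  rewrite big_seq [RHS]big_seq; apply: eq_bigr => y yZ.
  have y2Z : y ^+ 2 \in Z.
    move: yZ; rewrite !mem_filter expf_eq0 /= => /andP[-> /YP ky].
    by apply/YP; rewrite expr2; apply: kextM.
  rewrite (bigD1_seq _ y2Z uZ) /= eqxx big1 ?addr0 // => x.
  by rewrite eq_sym => /negPf->.
(* Each [y] is a square root of exactly one [x], so both sides contain the size of [Z]; cancelling
   it leaves the character sum over [Z]. *)
rewrite -[LHS]addr0 => /addrI; rewrite big_filter => sum0.
rewrite (bigID (fun y => y != 0)) /= -sum0 add0r big1 // => y.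
by rewrite negbK => /eqP->; apply: chi2_0.
Qed.

Lemma sum_chi2_translate x : x \in Y -> \sum_(y <- Y) chi2 #|k| d (x + y) = 0.
Proof.
move=> xY; rewrite -(big_map (+%R x) predT (fun z => chi2 #|k| d z)) -[RHS]sum_chi2.
apply: perm_big.
have uxY : uniq (map (+%R x) Y) by rewrite map_inj_uniq //; apply: addrI.
apply: uniq_perm => //; apply: (uniq_min_size uxY _ _).2; last by rewrite size_map.
by move=> _ /mapP[y /YP ky ->]; apply/YP/kextD => //; apply/YP.
Qed.

End Extension.
End CharacterSum.

(** * Equidistribution of values and the character sums over all forms *)

Section CharacterSumEvaluation.
Variables (k : finFieldType) (K : closedFieldType) (emb : {rmorphism k -> K}).
Variables (m : nat) (n r : 'I_m -> nat) (alpha : {ffun 'I_m -> option K}).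
Hypotheses (m_gt0 : (0 < m)%N) (n_gt0 : forall i, (0 < n i)%N).
Hypothesis hA : Aset K #|k| n alpha.

(* The forms [w] vanishing at the points other than [alpha i0] take every
   value of the field of [alpha i0] equally often. *)
Lemma count_interpolation d i0 (Y : seq K) y : (nsum n <= d.+1)%N ->
  uniq Y -> (size Y <= #|k| ^ n i0)%N ->
  (forall x, x \in Y <-> kext K #|k| (n i0) x) -> y \in Y ->
  count (fun w => [forall i in [set~ i0], hev emb d w (alpha i) == 0]
      && (hev emb d w (alpha i0) == y)) (polys k d.+1) =
  (#|k| ^ (d.+1 - nsum n))%N.
Proof.
move=> led uY sY YP.
pose van w := [forall i in [set~ i0], hev emb d w (alpha i) == 0].
pose W := [seq w <- polys k d.+1 | van w].
pose fib z := count (fun w => van w && (hev emb d w (alpha i0) == z)) (polys k d.+1).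
pose N := (#|k| ^ (d.+1 - nsum n))%N.
rewrite -/(van _) -/(fib y) -/N.
have nsumE : nsum n = (n i0 + \sum_(i in [set~ i0]) n i)%N.
  by rewrite /nsum (bigD1 i0) //=; congr addn; apply: eq_bigl => i; rewrite !inE.
have fib0 : fib 0 = N.
  have -> : N = (#|k| ^ (d.+1 - \sum_(i in [set: 'I_m]) n i))%N.
    by rewrite /N /nsum; congr (_ ^ (_ - _))%N; apply: eq_bigl => i; rewrite inE.
  rewrite -(count_vanishing emb n_gt0 hA); apply: eq_count => w.
  apply/andP/forall_inP => [[/forall_inP vw w0] i _|vw]; last first.
    by split; [apply/forall_inP => i _|]; apply: vw; rewrite inE.
  by have [->//|ni] := eqVneq i i0; apply: vw; rewrite !inE.
(* Subtracting a fixed member maps a nonempty fibre injectively into the fibre over [0]. *)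
have fib_le z : (fib z <= N)%N.
  rewrite -fib0; have [/hasP[w0 w0P /andP[vw0 /eqP Ew0]]|] :=
    boolP (has (fun w => van w && (hev emb d w (alpha i0) == z)) (polys k d.+1)); last first.
    by rewrite has_count -/(fib z) -leqNgt leqn0 => /eqP->.
  rewrite /fib -!size_filter -[leqLHS](size_map (fun w => w - w0)).
  apply: uniq_leq_size.
    by rewrite map_inj_uniq ?filter_uniq ?polys_uniq //; apply: addIr.
  move=> _ /mapP[w + ->]; rewrite !mem_filter => /andP[/andP[vw /eqP Ew] wP].
  rewrite hevD hevN Ew Ew0 subrr eqxx andbT; apply/andP; split.
    apply/forall_inP => i ni; rewrite hevD hevN.
    by rewrite (eqP (forall_inP vw i ni)) (eqP (forall_inP vw0 i ni)) subrr.
  move: wP w0P; rewrite !mem_polys => sw sw0.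
  by rewrite (leq_trans (size_polyD _ _)) // size_polyN geq_max sw.
(* The fibres partition the forms vanishing at the points other than [alpha i0]; [nsum n <= d + 1]
   keeps the exponent in their count untruncated. *)
have sum_fib : (\sum_(z <- Y) fib z = #|k| ^ n i0 * N)%N.
  transitivity (count van (polys k d.+1)).
    rewrite -sum1_count [RHS]big_mkcond /=.
    under eq_bigr do rewrite /fib -sum1_count big_mkcond /=.
    rewrite exchange_big; apply: eq_bigr => w _ /=.
    case: ifP => vw /=; last by rewrite big1.
    have wY : hev emb d w (alpha i0) \in Y by apply/YP/hev_kext; apply: hA.1.
    rewrite (bigD1_seq _ wY uY) /= eqxx big1 // => z.
    by rewrite eq_sym => /negPf->.
  rewrite (count_vanishing emb n_gt0 hA) -expnD; congr (_ ^ _)%N.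
  by move: led; rewrite nsumE; move: (n i0) (\sum_(i in _) _)%N => c e; lia.
(* At most [#|k| ^ n i0] fibres, each of size at most [N], add up to [#|k| ^ n i0 * N], so none is
   smaller than [N]. *)
move=> yY; apply/eqP; rewrite eqn_leq fib_le leqNgt /=; apply/negP => lt.
have: (\sum_(z <- Y) fib z < #|k| ^ n i0 * N)%N.
  apply: (@leq_trans (size Y * N)); last by rewrite leq_mul2r sY orbT.
  rewrite -sum1_size big_distrl /= (bigD1_seq _ yY uY) /= [leqRHS](bigD1_seq _ yY uY) /=.
  rewrite mul1n -addSn leq_add // leq_sum // => z _; by rewrite mul1n.
by rewrite sum_fib ltnn.
Qed.

(** Averaging over translations by the forms of [W] changes only the factor at [i0], which is the
    character itself since [r i0 = 1]. Its argument runs equally often through the whole field,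
    where the character sums to zero. *)
Lemma sum_chiprod_eq0 a i0 : odd #|k| -> (forall i, 0 < r i)%N -> r i0 = 1%N ->
  (nsum n <= (2 * a).+1)%N ->
  \sum_(h <- polys k (2 * a).+1) chiprod emb n r alpha a h = 0.
Proof.
move=> odd_q r_gt0 r1 leN; set d := (2 * a)%N.
pose van w := [forall i in [set~ i0], hev emb d w (alpha i) == 0].
pose W := [seq w <- polys k d.+1 | van w].
have [Y [uY sY YP]] := exists_kext_seq k K (n_gt0 i0).
set S := \sum_(h <- _) _.
have W0 : (size W)%:R != 0 :> rat.
  rewrite pnatr_eq0 -lt0n -has_predT; apply/hasP; exists 0 => //.
  rewrite mem_filter mem_polys size_poly0 andbT.
  by apply/forall_inP => i _; rewrite hev0.
apply: (mulfI W0); rewrite mulr0.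
transitivity (\sum_(w <- W) \sum_(h <- polys k d.+1) chiprod emb n r alpha a (h + w)).
  rewrite -sum1_size natr_sum mulr_suml big_seq [RHS]big_seq; apply: eq_bigr => w.
  rewrite mem_filter mem_polys => /andP[_ sw].
  by rewrite mul1r /S (perm_big _ (perm_polys_add sw)) big_map.
rewrite exchange_big big1 //= => h _.
transitivity (\sum_(w <- W) (\prod_(i < m | i != i0) chi2 #|k| (n i) (hev emb d h (alpha i)) ^+ r i)
   * chi2 #|k| (n i0) (hev emb d h (alpha i0) + hev emb d w (alpha i0))).
  rewrite big_seq [RHS]big_seq; apply: eq_bigr => w.
  rewrite mem_filter => /andP[/forall_inP vw _].
  rewrite /chiprod (bigD1 i0) //= r1 expr1 mulrC hevD; congr (_ * _).
  by apply: eq_bigr => i ni; rewrite hevD (eqP (vw i _)) ?addr0 // !inE.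
rewrite -mulr_sumr; set x := hev emb d h (alpha i0).
have xY : x \in Y by apply/YP/hev_kext; apply: hA.1.
suff -> : \sum_(w <- W) chi2 #|k| (n i0) (x + hev emb d w (alpha i0)) = 0 by rewrite mulr0.
transitivity (\sum_(y <- Y) (#|k| ^ (d.+1 - nsum n))%N%:R * chi2 #|k| (n i0) (x + y)); last first.
  by rewrite -mulr_sumr (sum_chi2_translate emb odd_q uY YP) ?mulr0.
transitivity (\sum_(w <- W) \sum_(y <- Y | hev emb d w (alpha i0) == y)
    chi2 #|k| (n i0) (x + y)).
  apply: eq_bigr => w _.
  have wY : hev emb d w (alpha i0) \in Y by apply/YP/hev_kext; apply: hA.1.
  rewrite big_mkcond (bigD1_seq _ wY uY) /= eqxx big1 ?addr0 // => z.
  by rewrite eq_sym => /negPf->.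
rewrite (exchange_big_dep predT) //= big_seq [RHS]big_seq; apply: eq_bigr => y yY.
rewrite -(count_interpolation leN uY sY YP yY) -sum1_count natr_sum mulr_suml.
by rewrite big_filter_cond; apply: eq_bigr => w _; rewrite mul1r.
Qed.

(** A squared character is [1] at nonzero values, so the sum counts the nonvanishing forms. *)
Lemma sum_chiprod_r2 a : (forall i, r i = 2%N) ->
  \sum_(h <- polys k (2 * a).+1) chiprod emb n r alpha a h =
  (#|k|%:R - 1) * bhat #|k| n (2 * a)%N%:Z.
Proof.
move=> r2; rewrite bhat_altsum // -(count_nonvanishing emb n_gt0 hA).
rewrite -sum1_count natr_sum [RHS]big_mkcond; apply: eq_bigr => h _.
case: ifPn => [/forallP nh|]; last first.
  by apply: chiprod_eq0 => i; rewrite r2.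
rewrite /chiprod big1 // => i _; rewrite r2 /chi2 (negPf (nh i)).
by case: ifP; rewrite ?expr1n ?sqrrN ?expr1n.
Qed.

End CharacterSumEvaluation.

(** * The moments [u] and their recurrence *)

Section Moments.
Variables (k : finFieldType) (K : closedFieldType) (emb : {rmorphism k -> K}).
Variables (m : nat) (n r : 'I_m -> nat).
Hypotheses (m_gt0 : (0 < m)%N) (n_gt0 : forall i, (0 < n i)%N).

Lemma finite_Aset : finite_set (Aset K #|k| n).
Proof.
have /fin_all_exists[Y YP] (i : 'I_m) :
    exists Y : seq K, forall x, x \in Y <-> kext K #|k| (n i) x.
  by have [Y [_ _ YP]] := exists_kext_seq k K (n_gt0 i); exists Y.
pose L : seq (option K) := None :: flatten [seq map Some (Y i) | i <- enum 'I_m].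
pose h (f : {ffun 'I_m -> seq_sub L}) : {ffun 'I_m -> option K} := [ffun i => val (f i)].
apply: (@sub_finite_set _ _ (h @` [set: {ffun 'I_m -> seq_sub L}])%classic);
  last exact/finite_image/finite_finset.
move=> alpha [hA _]; have aL i : alpha i \in L.
  rewrite inE; have := hA i; rewrite /P1kext; case: (alpha i) => [x /YP xY|//].
  apply/orP; right; apply/flattenP; exists (map Some (Y i)); last exact: map_f.
  by apply/map_f; rewrite mem_enum.
by exists [ffun i => SeqSub (aL i)] => //; apply/ffunP => i; rewrite !ffunE.
Qed.

Lemma PgE a : Pg k (a%:Z - 1) =
  [set` [seq f <- sqpolys k (2 * a).+1 | level f == a]]%classic.
Proof.
apply/seteqP; split => f; rewrite /= mem_filter mem_sqpolys /level.
  move=> [/asboolP-> sf]; move: (size f) sf => c sf; rewrite andbT.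
  by apply/andP; split; [apply/eqP|]; lia.
case/andP=> /eqP Ef /andP[sf /asboolP sqf]; split => //.
by move: (size f) Ef sf => c; lia.
Qed.

Lemma uE a : u emb n r (a%:Z - 1) =
  \sum_(alpha <- fset_set (Aset K #|k| n)) Iconst #|k| * sqsum emb n r alpha a.
Proof.
rewrite /u (fsbig_finite _ _ finite_Aset); apply: eq_bigr => alpha _; congr (_ * _).
rewrite PgE -fsbig_seq ?filter_uniq ?polys_uniq // big_filter.
by apply: eq_bigr => f _; apply: eq_bigr => i _; rewrite evalP1E.
Qed.

(** The recurrence stops at [j = nsum n - 1]; this allows that bound to be dropped, since
    [bhat_geom] makes all later coefficients zero. *)
Lemma sum_extend (V : nmodType) (G N : nat) (F : nat -> V) :
  (forall j, (N <= j)%N -> F j = 0) ->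
  \sum_(0 <= j < N | j%:Z <= G%:Z) F j = \sum_(j < G.+1) F j.
Proof.
move=> F0; rewrite -(big_mkord predT F).
rewrite (@big_nat_widen _ _ _ 0 N (N + G.+1)) ?leq_addr //.
rewrite (@big_nat_widen _ _ _ 0 G.+1 (N + G.+1)) ?leq_addl //.
rewrite big_mkcond [RHS]big_mkcond; apply: eq_bigr => j _ /=.
by rewrite lez_nat ltnS; case: (ltnP j N) => [|/F0->]; rewrite ?andbT // andbF if_same.
Qed.

(** Here [G] is [g] itself: the inner sums run over forms of degree [2 * g + 2] and [2 * g].
    Expanding both by [sum_chiprod], the second shifted by one index, produces the coefficients of
    the recurrence. *)
Lemma recurrence_lhs G : (forall i, 0 < r i)%N ->
  \sum_(0 <= j < nsum n | j%:Z <= G.+1%:Z)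
      (bhat #|k| n j%:Z - #|k|%:R * bhat #|k| n (j%:Z - 1)) * u emb n r (G%:Z - j%:Z) =
  \sum_(alpha <- fset_set (Aset K #|k| n)) Iconst #|k| *
    (\sum_(h <- polys k (2 * G.+1).+1) chiprod emb n r alpha G.+1 h
     - #|k|%:R * \sum_(h <- polys k (2 * G).+1) chiprod emb n r alpha G h).
Proof.
move=> r_gt0; rewrite sum_extend => [|j lej]; last first.
  by rewrite (bhat_geom (card_finNzRing_gt1 k) m_gt0 n_gt0 lej) mul0r.
transitivity (\sum_(j < G.+2) \sum_(alpha <- fset_set (Aset K #|k| n)) Iconst #|k| *
    ((bhat #|k| n j%:Z - #|k|%:R * bhat #|k| n (j%:Z - 1)) *
     sqsum emb n r alpha (G.+1 - j))).
  apply: eq_bigr => j _.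
  have -> : G%:Z - j%:Z = (G.+1 - j)%N%:Z - 1.
    by have := ltn_ord j; move: (j : nat) => i; lia.
  by rewrite uE mulr_sumr; apply: eq_bigr => alpha _; rewrite mulrCA.
rewrite exchange_big /= big_seq [RHS]big_seq; apply: eq_bigr => alpha.
rewrite in_fset_set ?inE; last exact: finite_Aset.
move=> hA; rewrite -mulr_sumr; congr (_ * _).
rewrite !(sum_chiprod emb m_gt0 n_gt0 r_gt0 hA).
under eq_bigr do rewrite mulrBl; rewrite sumrB; congr (_ - _).
(* The term [j = 0] vanishes because [bhat] is [0] at [-1]. *)
rewrite big_ord_recl /= mulr0 mul0r add0r mulr_sumr; apply: eq_bigr => j _.
by rewrite /bump leq0n add1n subn1 subSS mulrA.
Qed.

End Moments.

Theorem theorem4p14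
  (k : finFieldType) (hq : odd #|k|)
  (K : closedFieldType) (iota : {rmorphism k -> K})
  (hK : forall x : K, algebraicOver iota x)
  (m : nat) (hm : (1 <= m)%N)
  (n r : 'I_m -> nat)
  (hn : forall i, (1 <= n i)%N)
  (hr : forall i, r i = 1%N \/ r i = 2%N)
  (g : int) :
  let q := #|k| in
  let lhs : rat :=
    \sum_(0 <= j < nsum n | j%:Z <= g + 1)
      (bhat q n j%:Z - q%:R * bhat q n (j%:Z - 1)) * u iota n r (g - j%:Z) in
  ((forall i, r i = 2%N) -> 0 <= g ->
     lhs = Jconst K q n *
       (bhat q n (2 * g + 2) - q%:R * bhat q n (2 * g)))
  /\
  ((exists i, r i = 1%N) -> ((nsum n)%:R - 1) / 2 <= g%:~R :> rat ->
     lhs = 0).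
Proof.
move=> q lhs.
have m_gt0 : (0 < m)%N := hm.
have r_gt0 i : (0 < r i)%N by case: (hr i) => ->.
have nsum_gt0 : (0 < nsum n)%N.
  by rewrite /nsum (bigD1 (Ordinal m_gt0)) //= addn_gt0 hn.
have lhsE G : g = G%:Z -> lhs =
    \sum_(alpha <- fset_set (Aset K #|k| n)) Iconst #|k| *
    (\sum_(h <- polys k (2 * G.+1).+1) chiprod iota n r alpha G.+1 h
     - #|k|%:R * \sum_(h <- polys k (2 * G).+1) chiprod iota n r alpha G h).
  move=> gG; rewrite -(recurrence_lhs iota m_gt0 hn) // /lhs gG.
  by apply: eq_bigl => j; rewrite -addn1 PoszD.
split=> [r2 g0|[i0 r1] hg].
  have [G gG] : exists G : nat, g = G%:Z by exists `|g|%N; lia.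
  rewrite (lhsE G gG) big_seq /Jconst.
  under eq_bigr => alpha.
    rewrite in_fset_set ?inE; last exact: finite_Aset hn.
    move=> hA; rewrite !(sum_chiprod_r2 iota m_gt0 hn hA) //.
  over.
  (* The summand no longer depends on [alpha], so the sum brings out the number of tuples in
     [Jconst]. *)
  rewrite -big_seq big_const_seq count_predT iter_addr_0 -mulr_natr gG.
  have -> : 2 * G%:Z + 2 = (2 * G.+1)%N%:Z by lia.
  have -> : 2 * G%:Z = (2 * G)%N%:Z by lia.
  rewrite /q; ring.
have g0 : 0 <= g.
  have : 0 <= g%:~R :> rat.
    apply: le_trans hg; rewrite divr_ge0 // subr_ge0.
    by rewrite (ler_nat _ 1 (nsum n)).
  by rewrite ler0z.
have [G gG] : exists G : nat, g = G%:Z by exists `|g|%N; lia.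
(* The hypothesis on [g] is exactly the equidistribution bound for degree [2 * g]; the one for
   degree [2 * g + 2] follows, so both sums vanish. *)
have leN : (nsum n <= (2 * G).+1)%N.
  move: hg; rewrite gG -pmulrn ler_pdivrMr // lerBlDr -natrM natr1 ler_nat.
  by rewrite mulnC.
rewrite (lhsE G gG) big_seq big1 // => alpha.
rewrite in_fset_set ?inE; last exact: finite_Aset hn.
move=> hA; rewrite !(sum_chiprod_eq0 iota m_gt0 hn hA hq r_gt0 r1) ?mulr0 ?subr0 ?mulr0 //.
by apply: leq_trans leN _; lia.
Qed.
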